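(* Let $T>0$ be an integer and let $(\Sigma,\{\Theta_t\})$ be a discrete-time $T$-periodic dynamical system with $\Sigma\subseteq\mathbb{C}^n$. Then for every $\varepsilon>0$, every $m\in\mathbb{Z}$ with $2T\leq 2m\leq n$, and every $m$-system of history vectors $\mathbb{H}[\Sigma,m]=\{v_1,\ldots,v_m\}$ for $(\Sigma,\{\Theta_t\})$, the triple $(\Sigma,\{\Theta_t\},\mathbb{H}[\Sigma,m])$ is $(\mathbb{S}^1,T,\varepsilon)$-controlled, where $\mathbb{S}^1=\{z\in\mathbb{C}:|z|=1\}$.
   Context: A discrete-time dynamical system $(\Sigma,\{\Theta_t\})$ consists of a set $\Sigma\subseteq\mathbb{C}^n$ and continuous maps $\Theta_t:\Sigma\to\Sigma$ with $\Theta_0=\mathrm{id}_\Sigma$ and $\Theta_t\circ\Theta_s=\Theta_{t+s}$ for all integers $t,s\ge 0$. It is $T$-periodic if $\Theta_{t+T}=\Theta_t$ for every integer $t\ge 0$. An $m$-system of history vectors for it is $\mathbb{H}[\Sigma,m]=\{v_1,\ldots,v_m\}\subseteq\Sigma$ with $v_{k+1}=\Theta_k(v_1)$ for $0\le k\le m-1$ (so $v_{k+1}=\Theta_1(v_k)$ for $1\le k\le m-1$). For a square matrix $Z$, $\sigma(Z)$ is its spectrum and $\mathbb{C}[Z]=\{p(Z):p\in\mathbb{C}[z]\}$. A projection is a matrix $P$ with $P=P^\ast=P^2$. Algebra homomorphisms are linear and multiplicative, not necessarily unit-preserving. $CP(p,q)$ is the set of completely positive linear maps $\mathbb{C}^{p\times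 p}\to\mathbb{C}^{q\times q}$, i.e. maps $X\mapsto\sum_jW_jXW_j^\ast$ (finite sum) with $W_j\in\mathbb{C}^{q\times p}$. $\|\cdot\|$ denotes the Euclidean norm on vectors and the spectral norm on matrices. Let $\mathbb{M}\subseteq\mathbb{C}$ be a topological manifold. A topological control for $(\Sigma,\{\Theta_t\},\mathbb{H}[\Sigma,m])$ by $\mathbb{M}$ is a tuple $(\mathbb{M},Z,\hat K,\hat T,\varphi,\{f_t\})$ where $Z\in\mathbb{C}^{n\times n}$ has $\sigma(Z)\subseteq\mathbb{M}$, $\varphi:\mathbb{C}[Z]\to\mathbb{C}^{n\times n}$ is an algebra homomorphism, $\hat K,\hat T\in\mathbb{C}^{n\times n}$ are projections, and $(f_k)_{k\ge0}$ are polynomials in $\mathbb{C}[z]$, all belonging to the finite family $\{f_0,\ldots,f_{m-1}\}$, such that $\Theta_k(v_1)=\hat K\varphi(f_k(Z))\hat Tv_1$ for every $k\ge 0$. For an integer $r>0$ and $\varepsilon>0$, the triple $(\Sigma,\{\Theta_t\},\mathbb{H}[\Sigma,m])$ is $(\mathbb{M},r,\varepsilon)$-controlled if it has a topological control $(\mathbb{M},Z,\hat K,\hat T,\varphi,\{f_t\})$ of order $r$, meaning that there are $\Pi_r\in CP(n,r)$, $\Phi\in CP(r,n)$ and $\tilde v\in\mathbb{C}^n$ such that $\|\Theta_k(v_1)-\hat K\varphi(f_k(Z))\hat T\tilde v\|\le\varepsilon$ for every $k\ge 0$ and $\|\varphi(X)-\Phi(\Pi_r(X))\|\le\varepsilon$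 for every $X\in\mathbb{C}[Z]$.
   Formalization: The formal statement adds the hypothesis that if v_1 = 0 then Θ_1(v_1) = 0; without it the claim fails (Σ = {0, e}, Θ_1 swapping 0 and e, v_1 = 0), since a topological control forces Θ_k(0) = 0. *)

(* Defs.v *)
From HB Require Import structures.
From mathcomp Require Import all_boot all_order all_algebra complex.
From mathcomp Require Import all_classical all_reals all_analysis.

Set Implicit Arguments.
Unset Strict Implicit.
Unset Printing Implicit Defensive.

Import Order.TTheory GRing.Theory Num.Theory.
Import numFieldNormedType.Exports.
Local Open Scope classical_set_scope.
Local Open Scope ring_scope.
Local Open Scope sesquilinear_scope.

(* Viewing R[i] as a numClosedFieldType gives C, and matrices over C, their
   usual topology, which is not inferred for the bare type R[i]. *)
Definition Cplx (R : realType) : numClosedFieldType := complex R.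

Definition unit_circle (R : realType) : set (Cplx R) := [set z | `|z| = 1].

(* Locally Euclidean of some fixed dimension d. The Hausdorff and second
   countability conditions are automatic for subspaces of C. A chart is a map f
   from a relatively open set M `&` U onto an open V, with inverse g. *)
Definition topological_manifold (R : realType) (M : set (Cplx R)) : Prop :=
  exists d : nat, forall z : Cplx R, M z ->
    exists (U : set (Cplx R)) (V : set 'rV[R]_d)
           (f : Cplx R -> 'rV[R]_d) (g : 'rV[R]_d -> Cplx R),
      [/\ open U /\ U z, open V,
          set_fun (M `&` U) V f /\ set_fun V (M `&` U) g,
          (forall w, (M `&` U) w -> g (f w) = w) /\
          (forall x, V x -> f (g x) = x)
        & {within M `&` U, continuous f} /\ {within V, continuous g}].

(* Theta is given by functions on C^n; only their restrictions to Sigma matter. *)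
Record dynSystem (R : realType) (n : nat) := DynSystem {
  states : set 'cV[Cplx R]_n;
  flow : nat -> 'cV[Cplx R]_n -> 'cV[Cplx R]_n;
  flow_states : forall t, set_fun states states (flow t);
  flow_continuous : forall t, {within states, continuous (flow t)};
  flow0 : forall x, states x -> flow 0 x = x;
  flowD : forall t s x, states x -> flow t (flow s x) = flow (t + s) x
}.

Definition periodic_system (R : realType) (n : nat) (S : dynSystem R n) (T : nat) :
    Prop :=
  forall t x, states S x -> flow S (t + T) x = flow S t x.

(* v_1, ..., v_m are v`_0, ..., v`_(m - 1). *)
Definition history_system (R : realType) (n : nat) (S : dynSystem R n)
    (m : nat) (v : m.-tuple 'cV[Cplx R]_n) : Prop :=
  (forall x, x \in v -> states S x) /\
  (forall k, (k < m)%N -> v`_k = flow S k v`_0).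

Definition euclidean_norm (R : realType) (n : nat) (x : 'cV[Cplx R]_n) : R :=
  Num.sqrt (\sum_(i < n) Normc.normc (x i 0) ^+ 2).

Definition spectral_norm (R : realType) (n : nat) (A : 'M[Cplx R]_n) : R :=
  sup [set euclidean_norm (A *m x) | x in
        [set x : 'cV[Cplx R]_n | euclidean_norm x <= 1]].

Definition projection (R : realType) (n : nat) (P : 'M[Cplx R]_n) : Prop :=
  P = P ^t* /\ P = P *m P.

Definition spectrum (R : realType) (n : nat) (Z : 'M[Cplx R]_n) :
    set (Cplx R) :=
  [set a | eigenvalue Z a].

(* C[Z]; [horner_mx] is only available in dimension n.+1. *)
Definition poly_algebra (R : realType) (n : nat) (Z : 'M[Cplx R]_n.+1) :
    set 'M[Cplx R]_n.+1 :=
  range (horner_mx Z).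

(* Not required to map 1 to 1. Only the values of phi on A matter. *)
Definition algebra_hom (R : realType) (n : nat) (A : set 'M[Cplx R]_n)
    (phi : 'M[Cplx R]_n -> 'M[Cplx R]_n) : Prop :=
  (forall (a : Cplx R) X Y, A X -> A Y ->
     phi (a *: X + Y) = a *: phi X + phi Y) /\
  (forall X Y, A X -> A Y -> phi (X *m Y) = phi X *m phi Y).

Definition CP (R : realType) (p q : nat) :
    set ('M[Cplx R]_p -> 'M[Cplx R]_q) :=
  [set F | exists W : seq 'M[Cplx R]_(q, p),
     forall X, F X = \sum_(w <- W) w *m X *m w ^t*].

Record topological_control (R : realType) (n : nat) (S : dynSystem R n.+1)
    (m : nat) (v : m.-tuple 'cV[Cplx R]_n.+1) (M : set (Cplx R))
    (Z K T : 'M[Cplx R]_n.+1) (phi : 'M[Cplx R]_n.+1 -> 'M[Cplx R]_n.+1)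
    (f : nat -> {poly Cplx R}) : Prop := TopologicalControl {
  control_manifold : topological_manifold M;
  control_spectrum : spectrum Z `<=` M;
  control_hom : algebra_hom (poly_algebra Z) phi;
  control_projl : projection K;
  control_projr : projection T;
  control_family : forall k, exists j : 'I_m, f k = f j;
  control_eq : forall k,
    flow S k v`_0 = K *m phi (horner_mx Z (f k)) *m T *m v`_0
}.

Definition controlled (R : realType) (n : nat) (S : dynSystem R n.+1)
    (m : nat) (v : m.-tuple 'cV[Cplx R]_n.+1) (M : set (Cplx R))
    (r : nat) (eps : R) : Prop :=
  exists Z K T phi f, topological_control S v M Z K T phi f /\
    exists (Pi : 'M[Cplx R]_n.+1 -> 'M[Cplx R]_r)
           (Phi : 'M[Cplx R]_r -> 'M[Cplx R]_n.+1) (w : 'cV[Cplx R]_n.+1),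
      [/\ CP Pi, CP Phi,
          (forall k, euclidean_norm
             (flow S k v`_0 - K *m phi (horner_mx Z (f k)) *m T *m w) <= eps)
        & (forall X, poly_algebra Z X ->
             spectral_norm (phi X - Phi (Pi X)) <= eps)].

(* Main.v *)
(* Write the orbit v_1, ..., v_T as B d_1, ..., B d_T with B having orthonormal
   columns (Gram-Schmidt), and let Z be diagonal with distinct unit entries
   l_0, ..., l_n. The map phi(X) = V X V^* with V = B [1 | 0] sends p(Z) to
   B diag(p(l_0), ..., p(l_(T-1))) B^*, so it is multiplicative on C[Z] and is
   exactly the composite of the compression to the T x T corner with
   Y |-> B Y B^*. If P is the orthogonal projection onto the line of B c, where
   c is d_1 with its zero coordinates replaced by 1, and v_1 <> 0, then P v_1 is
   a nonzero multiple of B c, a cyclic vector for the matrices B diag(y) B^*.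
   Interpolating y at the l_j therefore reaches every v_k, with K = 1 and error
   0. If v_1 = 0, the whole orbit is 0. *)
Require Import Defs.
From mathcomp Require Import all_boot all_order all_algebra complex.
From mathcomp Require Import all_classical all_reals all_analysis.
From mathcomp Require Import ring.

Set Implicit Arguments.
Unset Strict Implicit.
Unset Printing Implicit Defensive.

Import Order.TTheory GRing.Theory Num.Theory.
Import numFieldNormedType.Exports.
Local Open Scope classical_set_scope.
Local Open Scope ring_scope.
Local Open Scope sesquilinear_scope.

(** * The Cayley transform from the real line to the unit circle without -1 *)

Definition cayley {C : numClosedFieldType} (t : C) : C :=
  (1 + 'i * t) / (1 - 'i * t).

(** On the unit circle without -1 this is the tangent of half the argument. *)
Definition inv_cayley {C : numClosedFieldType} (u : C) : C :=
  - 'i * ((u - 1) / (u + 1)).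

Section Cayley.
Context {C : numClosedFieldType}.
Implicit Types (t u : C).

Lemma conj_1DiM t : t \is Num.real -> (1 + 'i * t)^* = 1 - 'i * t.
Proof.
by move=> t_real; rewrite rmorphD rmorph1 rmorphM/= conjCi conj_Creal ?mulNr.
Qed.

(** The denominator and its conjugate add up to 2. *)
Lemma cayley_den_neq0 t : t \is Num.real -> 1 - 'i * t != 0.
Proof.
move=> t_real; apply/eqP => den0.
have /eqP : (2 : C) = (1 - 'i * t) + (1 - 'i * t)^*.
  by rewrite -{2}conj_1DiM // conjCK; ring.
by rewrite den0 rmorph0 addr0 pnatr_eq0.
Qed.

Lemma norm_cayley t : t \is Num.real -> `|cayley t| = 1.
Proof.
move=> t_real; rewrite normf_div -(norm_conjC (1 - _)) -conj_1DiM // conjCK.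
by rewrite divff // -norm_conjC conj_1DiM // normr_eq0 cayley_den_neq0.
Qed.

Lemma cayley_neqN1 t : t \is Num.real -> cayley t + 1 != 0.
Proof.
move=> /cayley_den_neq0 den; apply/eqP => e0.
have /eqP : cayley t + 1 = 2 / (1 - 'i * t) by rewrite /cayley; field.
by rewrite e0 eq_sym mulf_eq0 invr_eq0 pnatr_eq0 (negPf den).
Qed.

Lemma cayleyK t : t \is Num.real -> inv_cayley (cayley t) = t.
Proof.
move=> t_real; have den := cayley_den_neq0 t_real.
have -> : inv_cayley (cayley t) = - ('i * 'i) * t.
  rewrite /inv_cayley /cayley; field; rewrite den /=.
  by rewrite (_ : _ + _ = 2) ?pnatr_eq0 //; ring.
by rewrite -expr2 sqrCi opprK mul1r.
Qed.

Lemma inv_cayleyK u : u + 1 != 0 -> cayley (inv_cayley u) = u.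
Proof.
move=> u1; have iq : 'i * inv_cayley u = (u - 1) / (u + 1).
  by rewrite mulrA mulrN -expr2 sqrCi opprK mul1r.
rewrite /cayley iq; field; rewrite u1 /=.
by rewrite (_ : _ - _ = 2) ?pnatr_eq0 //; ring.
Qed.

(** Conjugation inverts [u] and negates ['i]; the two resulting sign changes cancel. *)
Lemma inv_cayley_real u : `|u| = 1 -> u + 1 != 0 -> inv_cayley u \is Num.real.
Proof.
move=> u1 uN1; apply/CrealP.
have u0 : u != 0 by rewrite -normr_eq0 u1 oner_eq0.
rewrite /inv_cayley rmorphM rmorphN/= conjCi fmorph_div.
rewrite rmorphB rmorphD rmorph1/=.
have -> : u^* = u^-1 by rewrite invC_norm u1 expr1n invr1 mul1r.
by field; rewrite u0 uN1.
Qed.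
End Cayley.

(** * The circle as a one-dimensional manifold *)

Section CayleyContinuity.
Context {K : numFieldType}.
Implicit Types (j t u : K).

Lemma continuous_cayley_frac j t : 1 - j * t != 0 ->
  {for t, continuous (fun x : K => (1 + j * x) / (1 - j * x))}.
Proof.
move=> den.
have ct : ( *%R j @ nbhs t --> (j * t : K)).
  exact: (@cvgMl_tmp K K (nbhs t) _ id j t cvg_id).
have c1 : cst 1 @ nbhs t --> (1 : K) by exact: cvg_cst.
exact: (cvgM (cvgD c1 ct) (cvgV den (cvgB c1 ct))).
Qed.

Lemma continuous_inv_cayley_frac j u : u + 1 != 0 ->
  {for u, continuous (fun x : K => j * ((x - 1) / (x + 1)))}.
Proof.
move=> u1.
have c1 : cst 1 @ nbhs u --> (1 : K) by exact: cvg_cst.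
have cu : id @ nbhs u --> u by exact: cvg_id.
exact: (cvgMl_tmp (cvgM (cvgB cu c1) (cvgV u1 (cvgD cu c1)))).
Qed.
End CayleyContinuity.

Lemma continuous_Re (R : realType) :
  continuous (fun z : Cplx R => complex.Re z : R).
Proof.
move=> z; apply/(@cvgrPdist_lt _ _ (Cplx R) (nbhs z)) => e e_gt0.
have e0 : 0 < (e%:C)%C :> Cplx R by rewrite ltcR.
have zw : \forall w \near z, `|z - w| < (e%:C)%C.
  exact: (@cvgr_dist_lt _ (Cplx R) _ (nbhs z) _ _ z cvg_id _ e0).
apply: filterS zw => w; rewrite -ltcR -raddfB; apply: le_lt_trans.
exact: normc_ge_Re.
Qed.

Lemma continuous_real_complex (R : realType) :
  continuous (fun x : R => (x%:C)%C : Cplx R).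
Proof.
move=> x; apply/cvgrPdist_lt => e.
(* The radius [e] is a complex number; being positive it is real, so the estimate can be carried out
   in [R]. *)
have e_real: e \is Num.real -> e = (complex.Re e)%:C%C by move=> /RRe_real.
move=> /[dup] /gtr0_real /e_real ->; rewrite ltcR => e0.
near=> y; rewrite -[_ - _](raddfB (@real_complex R)) normc_def /=.
rewrite expr0n addr0 sqrtr_sqr ltcR.
near: y; exact: cvgr_dist_lt.
Unshelve. all: by end_near. Qed.

(** The chart at [z] drops the antipode [- z], rotates [z] to 1 and applies the inverse Cayley
    transform, which is onto the real line. *)
Lemma unit_circle_manifold (R : realType) :
  topological_manifold (@unit_circle R).
Proof.
exists 1%N => z z1.
have z0 : z != 0 by rewrite -normr_eq0 z1 oner_eq0.
have uN1 w : w <> - z -> w / z + 1 != 0.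
  rewrite -(divff z0) -mulrDl => /eqP wN.
  by rewrite mulf_neq0 ?invr_eq0 // addr_eq0.
exists (~` [set - z]), setT,
  (fun w : Cplx R => complex.Re (inv_cayley (w / z)) *: const_mx 1),
  (fun x : 'rV_1 => z * cayley (x 0 0)%:C%C).
have real_real (x : R) : (x%:C)%C \is Num.real by apply/complex_realP; exists x.
split.
- split.
    rewrite openC; apply: accessible_closed_set1.
    by apply: hausdorff_accessible; exact: norm_hausdorff.
  move=> /= zN; have /eqP : z *+ 2 = 0 by rewrite mulr2n {1}zN addNr.
  by rewrite mulrn_eq0 (negPf z0).
- exact: openT.
- split; first by [].
  move=> x _; split => /=.
    by rewrite /unit_circle /= normrM norm_cayley ?mulr1.
  move=> gzN; move/eqP: (cayley_neqN1 (real_real (x 0 0))); apply.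
  by apply: (mulfI z0); rewrite mulrDr mulr1 gzN addNr mulr0.
- split=> [w [w1 wN]|x _].
    have u1 : `|w / z| = 1 by rewrite normf_div w1 z1 divr1.
    rewrite !mxE mulr1 RRe_real ?inv_cayley_real ?inv_cayleyK ?uN1 //.
    by rewrite mulrC divfK.
  apply/rowP => i; rewrite !ord1 !mxE mulr1 (mulrC z) mulfK //.
  by rewrite cayleyK.
- split.
    apply: continuous_in_subspaceT => w; rewrite inE => -[_ /= wN].
    have c1 : {for w, continuous (fun x : Cplx R => x / z)}.
      exact: (@cvgMr_tmp (Cplx R) _ (nbhs w) _ id _ _ cvg_id).
    have cz := @continuous_inv_cayley_frac (Cplx R) (- 'i) _ (uN1 _ wN).
    have c2 := cvg_comp _ _ c1 cz.
    have c3 := cvg_comp _ _ c2 (@continuous_Re R _).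
    exact: (@cvgZr_tmp R 'rV[R]_1 _ _ (nbhs_filter w) _ _ (const_mx 1) c3).
  apply: continuous_subspaceT => x.
  have den := cayley_den_neq0 (real_real (x 0 0)).
  have c1 := cvg_comp _ _ (@coord_continuous R 1 1 0 0 x)
    (@continuous_real_complex R _).
  have c2 := cvg_comp _ _ c1 (@continuous_cayley_frac (Cplx R) 'i _ den).
  exact: (@cvgMl_tmp (Cplx R) _ _ (nbhs_filter x) _ z _ c2).
Qed.

(** * Orthonormal bases, interpolation and projections onto lines *)

Section Matrices.
Context {C : numClosedFieldType}.

Lemma trmxC_mul m n p (A : 'M[C]_(m, n)) (B : 'M[C]_(n, p)) :
  (A *m B)^t* = B^t* *m A^t*.
Proof. by rewrite trmx_mul map_mxM. Qed.

Lemma pid_mx_compress_diag m n (le_mn : (m <= n)%N) (d : 'rV[C]_n) :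
  (pid_mx m : 'M[C]_(m, n)) *m diag_mx d *m (pid_mx m : 'M[C]_(m, n))^t* =
  diag_mx (\row_j d 0 (widen_ord le_mn j)).
Proof.
apply/matrixP => i j; rewrite mul_mx_diag !mxE (bigD1 (widen_ord le_mn i)) //=.
rewrite big1 ?addr0 => [|k /negPf ki]; rewrite !mxE /= !ltn_ord !andbT.
  rewrite eqxx mul1r eq_sym val_eqE.
  by case: eqP; rewrite ?rmorph_nat (mulr1, mulr0).
by rewrite -[(i == k :> nat)]/(widen_ord le_mn i == k) eq_sym ki !mul0r.
Qed.

(** Gram-Schmidt on the rows of the transpose yields [m] orthonormal rows even if [A] is rank
    deficient, so the columns need not be independent. *)
Lemma orthonormal_decomposition m n (A : 'M[C]_(n, m)) : (m <= n)%N ->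
  exists (B : 'M[C]_(n, m)) (D : 'M[C]_m), B^t* *m B = 1%:M /\ A = B *m D.
Proof.
move=> le_mn; have [D AD] := submxP (schmidt_sub A^T).
exists (schmidt A^T)^T, D^T; split; last by rewrite -trmx_mul -AD trmxK.
rewrite trmxK; apply: trmx_inj; rewrite trmx_mul trmxK trmx1.
have /unitarymxP <- := schmidt_unitarymx A^T le_mn.
by rewrite map_trmx.
Qed.

Lemma eigenvalue_diag_mx n (d : 'rV[C]_n) a :
  eigenvalue (diag_mx d) a -> exists i, a = d 0 i.
Proof.
rewrite eigenvalue_root_char char_poly_trig ?diag_mx_is_trig //.
rewrite rootE horner_prod prodf_seq_eq0 => /hasP[i _ /=].
by rewrite hornerXsubC subr_eq0 mxE eqxx => /eqP; exists i.
Qed.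

Lemma interpolation n (x : nat -> C) (y : 'I_n -> C) : injective x ->
  exists p : {poly C}, forall i : 'I_n, p.[x i] = y i.
Proof.
(* The Lagrange basis is taken over at least one node; without nodes any polynomial will do. *)
case: n y => [|n] y x_inj; first by exists 0; case.
exists (\sum_(i < n.+1) y i *: (tnth (n.+1.-lagrange x) i : {poly C})) => j.
rewrite horner_sum (bigD1 j) //= big1 ?addr0 => [|i /negPf ij];
  by rewrite hornerZ lagrange_sample // ?eqxx ?mulr1 // ij mulr0.
Qed.

Lemma dot_self_eq0 n (u : 'cV[C]_n) : (u^t* *m u) 0 0 = 0 -> u = 0.
Proof.
rewrite mxE (eq_bigr (fun i => `|u i 0| ^+ 2)) => [|i _]; last first.
  by rewrite normCKC !mxE.
move=> /(psumr_eq0P (fun i _ => exprn_ge0 2 (normr_ge0 (u i 0)))) u0.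
by apply/colP => i; apply/eqP; rewrite mxE -normr_eq0 -sqrf_eq0 u0.
Qed.

(* The junk value 0^-1 = 0 makes this the projection onto 0 when u = 0. *)
Definition line_proj n (u : 'cV[C]_n) : 'M[C]_n :=
  ((u^t* *m u) 0 0)^-1 *: (u *m u^t*).

Lemma line_projE n (u x : 'cV[C]_n) :
  line_proj u *m x = (((u^t* *m u) 0 0)^-1 * (u^t* *m x) 0 0) *: u.
Proof.
by rewrite -scalemxAl -mulmxA {1}[u^t* *m x]mx11_scalar mul_mx_scalar scalerA.
Qed.

Lemma line_proj_herm n (u : 'cV[C]_n) : line_proj u = (line_proj u)^t*.
Proof.
rewrite /line_proj linearZ /= map_mxZ trmxC_mul trmxCK fmorphV.
(* The scalar is the entry of a Hermitian 1 x 1 matrix, hence its own conjugate. *)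
congr (_^-1 *: _); rewrite -[in LHS](trmxCK (_ *m u)) trmxC_mul trmxCK.
by rewrite !mxE.
Qed.

Lemma line_proj_idem n (u : 'cV[C]_n) :
  line_proj u = line_proj u *m line_proj u.
Proof.
rewrite {3}/line_proj -scalemxAr mulmxA line_projE -scalemxAl.
rewrite -/(line_proj u) /line_proj.
have [->|a0] := eqVneq ((u^t* *m u) 0 0) 0; last by rewrite mulVf ?scale1r.
by rewrite invr0 !scale0r.
Qed.

Lemma diag_cyclic n (x w : 'cV[C]_n) : (forall i, x i 0 != 0) ->
  exists y : 'rV[C]_n, diag_mx y *m x = w.
Proof.
move=> x0; exists (\row_i (w i 0 / x i 0)); apply/colP => i.
by rewrite mul_diag_mx !mxE divfK.
Qed.

(** A single [P], depending only on [B] and [d], serves all targets [w], as one control must serve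
    all times. From [d = 0] only 0 can be reached, whence the condition on [w]. *)
Lemma cyclic_projection m n (B : 'M[C]_(n, m)) (d : 'cV[C]_m) :
  B^t* *m B = 1%:M ->
  exists P : 'M[C]_n, (P = P^t* /\ P = P *m P) /\
    forall w : 'cV_m, (d = 0 -> w = 0) ->
      exists y : 'rV_m, B *m diag_mx y *m B^t* *m P *m (B *m d) = B *m w.
Proof.
move=> BB; pose c := \col_i (if d i 0 == 0 then 1 else d i 0).
exists (line_proj (B *m c)); split.
  by split; [exact: line_proj_herm|exact: line_proj_idem].
have c0 i : c i 0 != 0 by rewrite mxE; case: ifPn => // _; exact: oner_neq0.
have dotB x : (B *m c)^t* *m (B *m x) = c^t* *m x.
  by rewrite trmxC_mul mulmxA -[_ *m B]mulmxA BB mulmx1.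
(* [c] differs from [d] only at coordinates where [d] vanishes. *)
have cd : c^t* *m d = d^t* *m d.
  apply/matrixP => i j; rewrite !ord1 !mxE; apply: eq_bigr => k _.
  by rewrite !mxE; case: eqP => // ->; rewrite !mulr0.
move=> w dw; have [d0|d0] := eqVneq d 0.
  by exists 0; rewrite d0 dw // !mulmx0.
pose s := ((c^t* *m c) 0 0)^-1 * (d^t* *m d) 0 0.
have s0 : s != 0.
  rewrite mulf_neq0 ?invr_eq0 //; apply: contra_neq d0;
    last exact: dot_self_eq0.
  (* As [c] has no zero coordinate, [c = 0] leaves no index at all, and [d = 0] holds vacuously. *)
  move=> /dot_self_eq0 cc; apply/colP => i; have := c0 i.
  by rewrite cc mxE eqxx.
have [|y yP] := @diag_cyclic _ (s *: c) w.
  by move=> i; rewrite mxE mulf_neq0.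
exists y; rewrite -!mulmxA line_projE !dotB cd -/s -scalemxAr -yP.
by rewrite -!scalemxAr; congr (_ *: _); rewrite [B^t* *m _]mulmxA BB mul1mx.
Qed.
End Matrices.

(** * The unitary diagonal matrix, its compression and the control *)

Section ControlledFlow.
Context {R : realType}.
Local Notation C := (Cplx R).

Lemma cayley_nat_inj : injective (fun k : nat => cayley (k%:R : C)).
Proof.
move=> j k /(congr1 inv_cayley); rewrite !cayleyK ?realn //.
by move=> /eqP; rewrite eqr_nat => /eqP.
Qed.

(** The eigenvalues are Cayley images of distinct integers, hence distinct interpolation nodes on
    the circle. *)
Definition cayley_mx n : 'M[C]_n := diag_mx (\row_(j < n) cayley j%:R).

Lemma spectrum_cayley_mx n : spectrum (cayley_mx n) `<=` @unit_circle R.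
Proof.
move=> a /eigenvalue_diag_mx[i ->].
by rewrite /unit_circle /= mxE norm_cayley ?realn.
Qed.

Lemma CP_conj p q (W : 'M[C]_(q, p)) : CP (fun X => W *m X *m W^t*).
Proof. by exists [:: W] => X; rewrite big_seq1. Qed.

Lemma euclidean_norm0 n : euclidean_norm (0 : 'cV[C]_n) = 0.
Proof.
rewrite /euclidean_norm big1 ?sqrtr0 // => i _.
by rewrite mxE Normc.normc0 expr0n.
Qed.

Lemma spectral_norm0 n : spectral_norm (0 : 'M[C]_n) = 0.
Proof.
rewrite /spectral_norm -[RHS]sup1; congr sup.
apply/seteqP; split=> [_ [x _ <-]|_ ->] /=.
  by rewrite mul0mx euclidean_norm0.
by exists 0; rewrite ?mulmx0 /= euclidean_norm0.
Qed.

Lemma flow_modn n (S : dynSystem R n) T : periodic_system S T ->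
  forall k x, states S x -> flow S k x = flow S (k %% T)%N x.
Proof.
move=> S_per k x Sx; rewrite {1}(divn_eq k T) addnC.
elim: (k %/ T)%N => [|q IHq]; first by rewrite addn0.
by rewrite mulSn addnCA addnC S_per.
Qed.

(** Serves the degenerate case of an orbit that starts at 0. *)
Lemma flow_fixpoint n (S : dynSystem R n) x : states S x ->
  flow S 1 x = x -> forall k, flow S k x = x.
Proof.
move=> Sx fx; elim=> [|k IHk]; first exact: flow0.
by rewrite -(addn1 k) -flowD // fx.
Qed.

Lemma compression_horner n T (B : 'M[C]_(n.+1, T)) (p : {poly C}) :
  (T <= n.+1)%N ->
  let V := B *m (pid_mx T : 'M[C]_(T, n.+1)) in
  V *m horner_mx (cayley_mx n.+1) p *m V^t* =
  B *m diag_mx (\row_(j < T) p.[cayley j%:R]) *m B^t*.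
Proof.
move=> leTn /=; rewrite /cayley_mx horner_mx_diag trmxC_mul !mulmxA.
rewrite -(mulmxA B) -(mulmxA B) (pid_mx_compress_diag leTn).
by congr (_ *m diag_mx _ *m _); apply/rowP => j; rewrite !mxE.
Qed.

(** A compression need not be multiplicative, but on polynomials in a diagonal matrix it only
    truncates the diagonal; the inner [B^t* *m B] then cancels. The unit goes to [B *m B^t*]. *)
Lemma compression_hom n T (B : 'M[C]_(n.+1, T)) :
  (T <= n.+1)%N -> B^t* *m B = 1%:M ->
  let V := B *m (pid_mx T : 'M[C]_(T, n.+1)) in
  algebra_hom (poly_algebra (cayley_mx n.+1)) (fun X => V *m X *m V^t*).
Proof.
move=> leTn BB V; split=> [a X Y _ _|_ _ [p _ <-] [q _ <-]].
  by rewrite mulmxDr mulmxDl -scalemxAr -scalemxAl.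
rewrite -[horner_mx _ p *m _]/(horner_mx _ p * horner_mx _ q) -rmorphM /=.
rewrite !compression_horner // !mulmxA -(mulmxA _ (B^t*)) BB mulmx1.
rewrite -(mulmxA B (diag_mx _) (diag_mx _)) mulmx_diag.
congr (_ *m diag_mx _ *m _).
by apply/rowP => j; rewrite !mxE hornerM.
Qed.
End ControlledFlow.

Theorem theorem3p2 (R : realType) (n T : nat) (S : dynSystem R n.+1)
    (T_gt0 : (0 < T)%N) (S_periodic : periodic_system S T)
    (eps : R) (eps_gt0 : 0 < eps)
    (m : nat) (leTm : (2 * T <= 2 * m)%N) (lemn : (2 * m <= n.+1)%N)
    (v : m.-tuple 'cV[Cplx R]_n.+1) (v_history : history_system S v)
    (v_zero : v`_0 = 0 -> flow S 1 v`_0 = 0) :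
  controlled S v (@unit_circle R) T eps.
Proof.
rewrite leq_mul2l /= in leTm.
have leTn : (T <= n.+1)%N.
  by rewrite (leq_trans leTm) // (leq_trans _ lemn) // leq_pmull.
have Sv0 : states S v`_0.
  by apply: v_history.1; rewrite mem_nth // size_tuple (leq_trans T_gt0).
have [B [D [BB AD]]] := orthonormal_decomposition
  (\matrix_(i < n.+1, k < T) flow S k v`_0 i 0) leTn.
have flowE (k : 'I_T) : flow S k v`_0 = B *m col k D.
  by rewrite colE mulmxA -AD -colE; apply/colP => i; rewrite !mxE.
have v0E : v`_0 = B *m col (Ordinal T_gt0) D by rewrite -flowE flow0.
have [P [Pproj Pcyc]] := cyclic_projection (col (Ordinal T_gt0) D) BB.
pose V := B *m (pid_mx T : 'M[Cplx R]_(T, n.+1)).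
pose phi X := V *m X *m V^t*.
pose Z : 'M[Cplx R]_n.+1 := cayley_mx n.+1.
(* Only times below [T] matter here; the polynomial 0 is a default for the others, which are later
   reduced modulo [T]. *)
have /choice[f fP] (k : nat) : exists p : {poly Cplx R}, (k < T)%N ->
    flow S k v`_0 = phi (horner_mx Z p) *m P *m v`_0.
  have [kT|//] := ltnP k T; last by exists 0.
  have [|y yP] := Pcyc (col (Ordinal kT) D).
    (* Here v_1 = 0, and [v_zero] makes 0 a fixed point, so every target column vanishes too. *)
    move=> d0; have v00 : v`_0 = 0 by rewrite v0E d0 mulmx0.
    have fix0 : flow S 1 v`_0 = v`_0 by rewrite v_zero.
    by rewrite -[LHS]mul1mx -BB -mulmxA -flowE flow_fixpoint // v00 mulmx0.
  have [p pP] := @interpolation _ T _ (y 0) (@cayley_nat_inj R).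
  exists p => _; rewrite /phi /V compression_horner // (_ : \row_j _ = y).
    by rewrite {2}v0E yP -flowE.
  by apply/rowP => j; rewrite mxE pP.
have phiE k :
    flow S k v`_0 = 1%:M *m phi (horner_mx Z (f (k %% T)%N)) *m P *m v`_0.
  by rewrite mul1mx -fP ?ltn_pmod // -flow_modn.
exists Z, 1%:M, P, phi, (fun k => f (k %% T)%N); split.
  split=> //.
  - exact: unit_circle_manifold.
  - exact: spectrum_cayley_mx.
  - exact: compression_hom.
  - by split; rewrite ?mulmx1 // trmx1 map_mx1.
  (* The remainder of [k] is below [T], hence below [m], and reducing it again changes nothing. *)
  - move=> k; have kT := ltn_pmod k T_gt0; exists (Ordinal (leq_trans kT leTm)).
    by rewrite /= modn_mod.
exists (fun X => pid_mx T *m X *m (pid_mx T)^t*),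
  (fun Y => B *m Y *m B^t*), v`_0.
split; [exact: CP_conj|exact: CP_conj| |].
  by move=> k; rewrite -phiE subrr euclidean_norm0 ltW.
move=> X _; rewrite (_ : _ - _ = 0) ?spectral_norm0 ?ltW //.
by rewrite /phi /V trmxC_mul !mulmxA subrr.
Qed.
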